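(* Let $T$ be a tree with $n$ vertices and let $\theta_1,\theta_2,\ldots,\theta_n$ be the eigenvalues of $T$ (listed with multiplicity). Then $$\mathrm{Pm}(C_4\times T)=\prod_{j=1}^{n}\left(2+\theta_j^2\right).$$
   Context: For a graph $G$, $\mathrm{Pm}(G)$ denotes the number of perfect matchings of $G$. $C_4$ is the cycle with 4 vertices, and $G\times H$ denotes the Cartesian product of graphs $G$ and $H$. The eigenvalues of a graph are the eigenvalues of its (0,1) adjacency matrix. *)

(* Defs.v *)
From mathcomp Require Import all_boot all_order all_algebra.

Set Implicit Arguments.
Unset Strict Implicit.
Unset Printing Implicit Defensive.

Import GRing.Theory.
Local Open Scope ring_scope.

Record sgraph := SGraph {
  svertex :> finType;
  adj : rel svertex;
  adj_sym : symmetric adj;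
  adj_irrefl : irreflexive adj
}.

Definition connected_graph (G : sgraph) : Prop :=
  (0 < #|G|)%N /\ forall x y : G, connect (@adj G) x y.

(* The bound on the size is needed: by symmetry [:: x; y] satisfies ucycleb
   for every edge xy. *)
Definition acyclic_graph (G : sgraph) : Prop :=
  forall c : seq G, (2 < size c)%N -> ~~ ucycleb (@adj G) c.

Definition is_tree (G : sgraph) : Prop :=
  connected_graph G /\ acyclic_graph G.

Definition C4_adj : rel 'I_4 := fun i j => (j == ordS i) || (i == ordS j).

Lemma C4_adj_sym : symmetric C4_adj.
Proof. by move=> i j; rewrite /C4_adj orbC. Qed.

Lemma C4_adj_irrefl : irreflexive C4_adj.
Proof. by case; case=> [|[|[|[|]]]]. Qed.

Definition C4 : sgraph := SGraph C4_adj_sym C4_adj_irrefl.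

Definition cart_adj (G H : sgraph) : rel (G * H) := fun x y =>
  ((x.1 == y.1) && adj x.2 y.2) || (adj x.1 y.1 && (x.2 == y.2)).

Lemma cart_adj_sym (G H : sgraph) : symmetric (@cart_adj G H).
Proof.
move=> x y; rewrite /cart_adj (eq_sym x.1) (eq_sym x.2).
by rewrite (adj_sym x.1) (adj_sym x.2).
Qed.

Lemma cart_adj_irrefl (G H : sgraph) : irreflexive (@cart_adj G H).
Proof. by move=> x; rewrite /cart_adj !adj_irrefl andbF. Qed.

Definition cart_prod (G H : sgraph) : sgraph :=
  SGraph (@cart_adj_sym G H) (@cart_adj_irrefl G H).

Definition edges (G : sgraph) : {set {set G}} :=
  [set e : {set G} | [exists x : G, exists y : G, adj x y && (e == [set x; y])]].

Definition perfect_matching (G : sgraph) (M : {set {set G}}) : bool :=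
  (M \subset edges G) && [forall v : G, #|[set e in M | v \in e]| == 1%N].

Definition Pm (G : sgraph) : nat :=
  #|[set M : {set {set G}} | perfect_matching M]|.

Definition adjmx (R : nzRingType) (G : sgraph) : 'M[R]_#|G| :=
  \matrix_(i, j) (adj (enum_val i) (enum_val j))%:R.

(* theta lists all the eigenvalues of G with their (algebraic) multiplicities:
   the characteristic polynomial splits as the product of the 'X - theta j.
   A full list exists over any real closed or algebraically closed field F,
   the adjacency matrix being symmetric. *)
Definition graph_eigenvalues (F : fieldType) (G : sgraph) (n : nat)
    (theta : 'I_n -> F) : Prop :=
  char_poly (adjmx F G) = \prod_(j < n) ('X - (theta j)%:P).

(* Main.v *)
(** Split a tree along an edge rq at its root into rooted trees (W1, r) and
    (W2, q). A perfect matching of C4 x T picks some of the four rungs above rq,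
    so it is enough to count, for each subset s of the fibre above the root, the
    perfect matchings of C4 x W avoiding s. These counts are a if s is empty, b if
    s is a pair of neighbours, c if s is the whole fibre, and 0 otherwise, and
    gluing gives
      a = a1 a2 + 4 b1 b2 + c1 c2,   b = b1 a2 + c1 b2,   c = c1 a2.
    The characteristic polynomials P of W and Q of W - r satisfy
      P = P1 P2 - Q1 Q2,   Q = Q1 P2,
    so P^2, PQ/x and Q^2 are polynomials in y = x^2 obeying, at y = -2 and up to
    sign, the same recurrences as a, b, c. Hence a = |P(sqrt(-2))|^2, which is the
    product of the 2 + theta_j^2. *)

Require Import Defs.
From mathcomp Require Import all_boot all_order all_algebra.
From mathcomp Require Import perm.
From mathcomp Require Import ring.

Set Implicit Arguments.
Unset Strict Implicit.
Unset Printing Implicit Defensive.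

Import GRing.Theory.
Local Open Scope ring_scope.

(** * Induction over rooted induced subgraphs of an acyclic graph *)

(* [r] and [q] need not be adjacent: this covers disconnected [W], for which there is
   no edge at all between [W1] and [W2]. *)
Lemma forest_ind (T : sgraph) (P : T -> {set T} -> Prop) :
  acyclic_graph T ->
  (forall r, P r [set r]) ->
  (forall r q (W1 W2 : {set T}), r \in W1 -> q \in W2 -> [disjoint W1 & W2] ->
     (forall x y, x \in W1 -> y \in W2 -> adj x y -> x = r /\ y = q) ->
     P r W1 -> P q W2 -> P r (W1 :|: W2)) ->
  forall r (W : {set T}), r \in W -> P r W.
Proof.
move=> acT Pbase Pglue r W; move: {2}#|W| (leqnn #|W|) => n.
elim: n r W => [|n IHn] r W.
  by rewrite leqn0 cards_eq0 => /eqP->; rewrite inE.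
move=> leWn rW.
have ltW (W' : {set T}) x : x \in W -> x \notin W' -> W' \subset W -> (#|W'| <= n)%N.
  move=> xW xW' sW'; rewrite -ltnS; apply: leq_trans leWn.
  by apply: proper_card; rewrite properE sW'; apply/subsetPn; exists x.
case: (pickP [pred q | (q \in W) && adj r q]) => [q /andP[qW rq] | norq]; last first.
  (* With no neighbour of [r] inside [W], the root is split off alone, and any remaining vertex can
     serve as the root of the rest. *)
  case: (set_0Vmem (W :\ r)) => [W0 | [q qWr]].
    by rewrite -(setD1K rW) W0 setU0.
  rewrite -(setD1K rW); apply: (Pglue r q) => //; rewrite ?inE //.
  - by rewrite disjoints1 !inE eqxx.
  - move=> x y; rewrite !inE => /eqP-> /andP[_ yW] ry.
    by have := norq y; rewrite /= yW ry.
  - apply: IHn => //; apply: (ltW _ r) => //; rewrite ?inE ?eqxx //.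
    exact: subsetDl.
pose e' := [rel x y : T | [&& adj x y, x \in W :\ r & y \in W :\ r]].
have qr : q != r by apply: contraTneq rq => ->; rewrite adj_irrefl.
(* The component of [q] in [W] minus [r]; the remainder of [W] keeps the root [r]. *)
pose W2 := [set x | connect e' q x].
have qW2 : q \in W2 by rewrite inE connect0.
have W2W x : x \in W2 -> x \in W :\ r.
  rewrite inE => /connectP[p]; elim/last_ind: p => [|p y _].
    by move=> _ ->; rewrite !inE qr.
  by rewrite rcons_path last_rcons => /andP[_ /and3P[_ _ yW]] ->.
have sW2 : W2 \subset W by apply/subsetP=> x /W2W; rewrite inE => /andP[].
have rW2 : r \notin W2 by apply/negP=> /W2W; rewrite !inE eqxx.
have eW : W = (W :\: W2) :|: W2.
  by rewrite setUC setDE setUIr setUCr setIT; apply/esym/setUidPr.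
rewrite {}[in X in P r X]eW; apply: (Pglue r q) => //.
- by rewrite in_setD rW rW2.
- by rewrite disjoint_sym disjoints_subset; apply/subsetP=> x xW2; rewrite in_setC in_setD xW2.
- move=> x y; rewrite in_setD => /andP[xW2 xW] yW2 xy.
  (* Any other neighbour of [W2] inside [W] would itself be reachable from [q] without passing
     through [r]. *)
  have xr : x = r.
    apply/eqP; apply: contraNT xW2 => xr; move: (yW2); rewrite !inE => qy.
    apply: connect_trans qy (connect1 _).
    by rewrite /= adj_sym xy W2W // !inE xr.
  rewrite {}xr {x xW xW2} in xy *; split=> //.
  (* If [y] differed from [q], a duplicate-free path from [q] to [y] avoiding [r] would close up
     through [r] into a cycle with at least three vertices. *)
  move: (yW2); rewrite inE => /connectP[p /shortenP[p' pth' up' _] yE].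
  apply/eqP; apply: contraT => yq.
  have p'W : all (mem (W :\ r)) p'.
    apply/allP=> z zp'; apply: W2W; rewrite inE.
    move: pth'; case/splitPr: zp' => p1 p2; rewrite -cat_rcons cat_path.
    by case/andP=> pth1 _; apply/connectP; exists (rcons p1 z); rewrite ?last_rcons.
  have pa : path (@adj T) q p' by apply: sub_path pth' => u v /= /and3P[].
  have : ~~ ucycleb (@adj T) [:: r, q & p'].
    apply: acT; rewrite /=; case: (p') yE => [|//] /= yE.
    by rewrite yE eqxx in yq.
  rewrite /ucycleb [cycle _ _]/= rcons_path rq pa -yE adj_sym xy /=.
  move: up'; rewrite /= inE => ->; rewrite andbT negbK eq_sym (negPf qr) /=.
  by move/(allP p'W); rewrite !inE eqxx.
- apply: IHn; last by rewrite in_setD rW rW2.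
  by apply: (ltW _ q) => //; [rewrite in_setD qW2 | apply: subsetDl].
- by apply: IHn => //; apply: (ltW _ r).
Qed.

(** * Determinants of principal submatrices coupled by a single pair of entries *)

(* The principal submatrix on [W], padded with the identity outside [W] so that all
   these matrices have the same size. *)
Definition principal_mx (R : comNzRingType) n (B : 'M[R]_n) (W : {set 'I_n}) :=
  \matrix_(i, j) if (i \in W) && (j \in W) then B i j else (i == j)%:R.

Definition set_row (R : comNzRingType) n (i0 : 'I_n) (u : 'rV[R]_n) (A : 'M[R]_n) :=
  \matrix_(i, j) if i == i0 then u 0 j else A i j.

Section Determinants.
Variables (R : comNzRingType) (n : nat).
Implicit Types (A B : 'M[R]_n) (W : {set 'I_n}) (u v : 'rV[R]_n).

Lemma det_set_rowD i0 u v (b : R) A :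
  \det (set_row i0 (u + b *: v) A) =
  \det (set_row i0 u A) + b * \det (set_row i0 v A).
Proof.
rewrite -[\det (set_row i0 u A)]mul1r; apply: (determinant_multilinear (i0 := i0)).
- by apply/rowP=> j; rewrite !mxE eqxx mul1r.
- by apply/matrixP=> i j; rewrite !mxE eq_sym (negPf (neq_lift _ _)).
- by apply/matrixP=> i j; rewrite !mxE eq_sym (negPf (neq_lift _ _)).
Qed.

Lemma set_row_row i0 A : set_row i0 (row i0 A) A = A.
Proof. by apply/matrixP=> i j; rewrite !mxE; case: eqP => [->|]. Qed.

(** By the pigeonhole principle no permutation maps [X] into [Y], so every Leibniz term contains a
    zero entry. *)
Lemma det_zero_block A (X Y : {set 'I_n}) :
  (#|Y| < #|X|)%N -> (forall i j, i \in X -> j \notin Y -> A i j = 0) -> \det A = 0.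
Proof.
move=> ltYX A0; apply: big1 => s _.
have /subsetPn[j /imsetP[i iX ->] jY] : ~~ (s @: X \subset Y).
  apply: contraL ltYX => /subset_leq_card; rewrite -leqNgt card_imset //.
  exact: perm_inj.
by rewrite (bigD1 i) //= A0 // mul0r mulr0.
Qed.

(** Only permutations fixing [i0] contribute, and these never meet column [i0] in another row. *)
Lemma det_row_delta A B i0 :
  (forall j, A i0 j = (i0 == j)%:R) -> (forall j, B i0 j = (i0 == j)%:R) ->
  (forall i j, i != i0 -> j != i0 -> A i j = B i j) -> \det A = \det B.
Proof.
move=> A0 B0 AB; apply: eq_bigr => s _; congr (_ * _).
rewrite (bigD1 i0) //= [in RHS](bigD1 i0) //= A0 B0.
case: eqP => [si0|_]; last by rewrite !mul0r.
congr (_ * _); apply: eq_bigr => i ii0; apply: AB => //.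
by apply: contraNneq ii0; rewrite {1}si0 => /perm_inj->.
Qed.

(** Thanks to the identity padding, each factor acts on its own block and fixes the other
    coordinates. *)
Lemma principal_mxU B W1 W2 : [disjoint W1 & W2] ->
  (forall i j, i \in W1 -> j \in W2 -> B i j = 0 /\ B j i = 0) ->
  principal_mx B (W1 :|: W2) = principal_mx B W1 *m principal_mx B W2.
Proof.
move=> dW B0; apply/matrixP=> i j; rewrite !mxE.
have d1 k : k \in W1 -> (k \in W2) = false.
  by move/(disjointFr dW).
have d2 k : k \in W2 -> (k \in W1) = false.
  by move/(disjointFl dW).
case i1: (i \in W1); last first.
  rewrite (bigD1 i) //= big1 => [|k]; rewrite !mxE i1 /= ?eqxx ?mul1r ?addr0 //; last first.
    by rewrite eq_sym => /negPf->; rewrite mul0r.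
  rewrite !inE i1 /=; case i2: (i \in W2) => //=; case j1: (j \in W1) => //=.
  by rewrite (d1 j j1) (B0 j i j1 i2).2; case: eqP => // ij; rewrite -ij i1 in j1.
case j2: (j \in W2); last first.
  rewrite (bigD1 j) //= big1 => [|k kj];
    rewrite !mxE ?i1 ?j2 /= ?andbF ?eqxx ?mulr1 ?addr0 //; last first.
    by rewrite (negPf kj) mulr0.
  by rewrite !inE i1 j2 orbF.
rewrite big1 => [|k _].
  by rewrite !inE i1 j2 orbT /= (B0 i j i1 j2).1.
rewrite !mxE i1 j2 /= andbT; case k1: (k \in W1).
  rewrite (d1 k k1); case: eqP => [kj|]; last by rewrite mulr0.
  by rewrite kj (d2 j j2) in k1.
by case: eqP => [ik|]; rewrite ?mul0r // -ik i1 in k1 *.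
Qed.

Lemma det_principal_mx_row B W r : r \in W ->
  \det (set_row r (delta_mx 0 r) (principal_mx B W)) = \det (principal_mx B (W :\ r)).
Proof.
move=> rW; apply: (@det_row_delta _ _ r) => [j|j|i j ir jr]; rewrite !mxE ?eqxx //=.
- by rewrite eq_sym.
- by rewrite !inE eqxx.
- by rewrite !inE ir jr (negPf ir).
Qed.

(** A contributing permutation uses both coupling entries or neither. Using both amounts to
    transposing [r] and [q] over the blocks with these indices removed, whence the minus sign. *)
Lemma det_principal_mxU B W1 W2 r q : [disjoint W1 & W2] -> r \in W1 -> q \in W2 ->
  (forall i j, i \in W1 -> j \in W2 -> ~~ ((i == r) && (j == q)) ->
     B i j = 0 /\ B j i = 0) ->
  \det (principal_mx B (W1 :|: W2)) =
  \det (principal_mx B W1) * \det (principal_mx B W2) -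
  B r q * B q r * (\det (principal_mx B (W1 :\ r)) * \det (principal_mx B (W2 :\ q))).
Proof.
move=> dW r1 q2 B0.
have d1 k : k \in W1 -> (k \in W2) = false by move/(disjointFr dW).
have d2 k : k \in W2 -> (k \in W1) = false by move/(disjointFl dW).
have qr : q == r = false by apply: contraTF q2 => /eqP->; rewrite (d1 r r1).
have rq : r == q = false by rewrite eq_sym.
(* [B'] is [B] with the coupling entries erased, so that its principal matrix on the union is a
   product of two blocks. *)
pose B' := \matrix_(i, j)
  if (i == r) && (j == q) || (i == q) && (j == r) then 0 else B i j.
have B'0 i j : i \in W1 -> j \in W2 -> B' i j = 0 /\ B' j i = 0.
  move=> i1 j2; rewrite !mxE.
  have [/andP[/eqP-> /eqP->]|ne] := boolP ((i == r) && (j == q)).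
    by rewrite !eqxx orbT.
  have [-> ->] := B0 i j i1 j2 ne.
  by rewrite if_same if_same.
have pB1 : principal_mx B' W1 = principal_mx B W1.
  apply/matrixP=> i j; rewrite !mxE; case i1: (i \in W1); case j1: (j \in W1) => //=.
  have /negPf-> : j != q by apply: contraTneq q2 => <-; rewrite (d1 j j1).
  have /negPf-> : i != q by apply: contraTneq q2 => <-; rewrite (d1 i i1).
  by rewrite andbF.
have pB2 : principal_mx B' W2 = principal_mx B W2.
  apply/matrixP=> i j; rewrite !mxE; case i2: (i \in W2); case j2: (j \in W2) => //=.
  have /negPf-> : j != r by apply: contraTneq r1 => <-; rewrite (d2 j j2).
  have /negPf-> : i != r by apply: contraTneq r1 => <-; rewrite (d2 i i2).
  by rewrite andbF.
set N := principal_mx B' (W1 :|: W2).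
have NE : N = principal_mx B W1 *m principal_mx B W2 by rewrite /N principal_mxU // pB1 pB2.
have N1 i j : i \in W1 -> j \notin W1 -> N i j = 0.
  move=> i1 j1; rewrite mxE !inE i1 (negPf j1) /=.
  case j2: (j \in W2); first exact: (B'0 i j i1 j2).1.
  by case: eqP => // ij; rewrite -ij i1 in j1.
have N2 i j : i \in W2 -> j \notin W2 -> N i j = 0.
  move=> i2 j2; rewrite mxE !inE i2 (negPf j2) orbT orbF /=.
  case j1: (j \in W1); first exact: (B'0 j i j1 i2).2.
  by case: eqP => // ij; rewrite -ij i2 in j2.
pose e i : 'rV[R]_n := delta_mx 0 i.
(* Restoring the coupling adds a multiple of a unit vector to each of the rows [r] and [q];
   multilinearity then yields four determinants. *)
have -> : principal_mx B (W1 :|: W2) =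
    set_row r (row r N + B r q *: e q) (set_row q (row q N + B q r *: e r) N).
  apply/matrixP=> i j; rewrite !mxE; case: (i =P r) => [->|/eqP ir].
    rewrite !inE r1 rq eqxx /= orbF; case: (j =P q) => [->|_].
      by rewrite q2 orbT add0r mulr1.
    by rewrite mulr0 addr0.
  case: (i =P q) => [->|/eqP iq].
    rewrite !inE q2 orbT qr eqxx /=; case: (j =P r) => [->|_].
      by rewrite r1 add0r mulr1.
    by rewrite mulr0 addr0.
  by [].
have NmxE i j : N i j =
    if (i \in W1 :|: W2) && (j \in W1 :|: W2) then B' i j else (i == j)%:R.
  by rewrite mxE.
clearbody N.
have swap u v : set_row r u (set_row q v N) = set_row q v (set_row r u N).
  by apply/matrixP=> i j; rewrite !mxE; case: (i =P r) => // ->; rewrite rq.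
rewrite det_set_rowD !(swap, det_set_rowD) -!swap.
have -> : set_row r (row r N) (set_row q (row q N) N) = N by rewrite !set_row_row.
(* The rows in [W1] together with row [q] are supported on the columns in [W1], which are one too
   few. The next term vanishes symmetrically. *)
have -> : \det (set_row r (row r N) (set_row q (e r) N)) = 0.
  apply: (@det_zero_block _ (q |: W1) W1).
    by rewrite cardsU1 (d2 q q2).
  move=> i j; rewrite !inE !mxE => iW j1; case: (i =P r) => [_|ir]; first exact: N1.
  case: (i =P q) iW => [_ _|_ /= i1]; last exact: N1.
  by case: (j =P r) => // jr; rewrite jr r1 in j1.
have -> : \det (set_row r (e q) (set_row q (row q N) N)) = 0.
  apply: (@det_zero_block _ (r |: W2) W2).
    by rewrite cardsU1 (d1 r r1).
  move=> i j; rewrite !inE !mxE => iW j2; case: (i =P r) iW => [_ _|_ /= i2].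
    by case: (j =P q) => // jq; rewrite jq q2 in j2.
  by case: (i =P q) => [_|_]; apply: N2.
(* Swapping rows [r] and [q] puts both unit vectors on the diagonal, at the cost of a sign. *)
have -> : \det (set_row r (e q) (set_row q (e r) N)) =
    - \det (set_row r (e r) (set_row q (e q) N)).
  have -> : set_row r (e q) (set_row q (e r) N) =
      xrow r q (set_row r (e r) (set_row q (e q) N)).
    apply/matrixP=> i j; rewrite !mxE; case: (i =P r) => [->|/eqP ir].
      by rewrite tpermL qr !eqxx.
    case: (i =P q) => [->|/eqP iq]; first by rewrite tpermR !eqxx.
    by rewrite tpermD ?(eq_sym _ i) // (negPf ir) (negPf iq).
  rewrite xrowE det_mulmx det_perm odd_tperm rq /=.
  by rewrite expr1 mulN1r.
have -> : set_row r (e r) (set_row q (e q) N) =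
    set_row r (e r) (principal_mx B W1) *m set_row q (e q) (principal_mx B W2).
  apply/matrixP=> i j; rewrite [RHS]mxE.
  have D i' k : i' \notin W1 -> i' != r ->
      set_row r (e r) (principal_mx B W1) i' k = (i' == k)%:R.
    by move=> i1 ir; rewrite !mxE (negPf i1) (negPf ir).
  have E k : k \in W1 -> set_row q (e q) (principal_mx B W2) k j = (k == j)%:R.
    move=> k1; rewrite !mxE (d1 k k1) /=; case: (k =P q) => // kq.
    by rewrite -kq (d1 k k1) in q2.
  have [->|ir] := eqVneq i r.
    rewrite (bigD1 r) //= big1 => [|k kr].
      by rewrite E // !mxE !eqxx mul1r addr0 eq_sym.
    by rewrite !mxE eqxx (negPf kr) mul0r.
  have [i1|i1] := boolP (i \in W1); last first.
    rewrite (bigD1 i) //= big1 => [|k ki]; last by rewrite D // eq_sym (negPf ki) mul0r.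
    rewrite D // eqxx mul1r addr0 !mxE (negPf ir); case: (i =P q) => // _.
    rewrite NmxE !inE (negPf i1) /=; case i2: (i \in W2) => //=.
    have [j2|j2] := boolP (j \in W2).
      rewrite orbT mxE (negPf ir) /=; case: ifP => // /andP[_ /eqP jr].
      by rewrite jr (d1 r r1) in j2.
    have := N2 i j i2 j2; rewrite NmxE !inE i2 orbT /= (negPf j2) orbF => ->.
    by case: eqP => // ij; rewrite -ij i2 in j2.
  (* Row [i] of the first factor is supported on [W1], so the altered row [q] of the second factor
     is never reached. *)
  rewrite (eq_bigr (fun k => principal_mx B W1 i k * principal_mx B W2 k j)); last first.
    move=> k _; rewrite [X in X * _]mxE (negPf ir).
    have [k1|k1] := boolP (k \in W1).
      by rewrite E // [principal_mx B W2 _ _]mxE (d1 k k1).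
    rewrite [principal_mx B W1 _ _]mxE (negPf k1) andbF.
    by case: (i =P k) => [ik|]; rewrite ?mul0r // -ik i1 in k1 *.
  have -> : \sum_k principal_mx B W1 i k * principal_mx B W2 k j = N i j.
    by rewrite NE mxE.
  rewrite mxE (negPf ir) mxE; case: (i =P q) => // iq.
  by rewrite iq (d2 q q2) in i1.
rewrite NE !det_mulmx !det_principal_mx_row //.
ring.
Qed.

End Determinants.

(** * Counting exact covers *)

(* [M] is an exact cover of [U] by members of [E]. For [E] the edges of a graph,
   this is a perfect matching of the subgraph induced on [U]. *)
Definition npart (V : finType) (E : {set {set V}}) (U : {set V}) :=
  #|[set M : {set {set V}} | (M \subset E) && partition M U]|.

Section Partitions.
Variable V : finType.
Implicit Types (E M : {set {set V}}) (U e : {set V}).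

Lemma eq_npart E E' U :
  (forall e, e \subset U -> (e \in E) = (e \in E')) -> npart E U = npart E' U.
Proof.
move=> EE'; apply: eq_card => M; rewrite !inE.
case pM: (partition M U); rewrite ?andbF ?andbT //.
by apply/subsetP/subsetP=> sM e eM; move: (sM e eM); rewrite EE' //; apply: partitionS eM.
Qed.

Lemma npart_set0 U : npart set0 U = (U == set0).
Proof.
have H M : (M \subset set0) && partition M U = (M == set0) && (U == set0).
  rewrite subset0; case: eqP => //= ->; apply/idP/eqP => [/cover_partition<-|->].
    by rewrite /cover big_set0.
  by rewrite partition_set0.
rewrite /npart; case U0: (U == set0).
  by rewrite (eq_card (B := pred1 set0)) ?card1 // => M; rewrite !inE H U0 andbT.
by apply: eq_card0 => M; rewrite !inE H U0 andbF.
Qed.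

(** Covers are sorted by whether they contain [e]; removing [e] from those that do gives the covers
    of [U :\: e]. *)
Lemma npart_del E e U : e \in E -> e != set0 ->
  npart E U =
  (npart (E :\ e) U + if e \subset U then npart (E :\ e) (U :\: e) else 0)%N.
Proof.
move=> eE e0; rewrite /npart -(cardsID [set M : {set {set V}} | e \in M]) addnC; congr (_ + _)%N.
  by apply: eq_card => M; rewrite !inE subsetD1 andbA (andbC (e \notin M)).
case: ifP => [eU|neU]; last first.
  apply: eq_card0 => M; rewrite !inE; apply/negP=> /andP[/andP[_ pM] eM].
  by rewrite (partitionS pM eM) in neU.
rewrite -[RHS](card_in_imset (f := fun M => e |: M)).
  apply: eq_card => M; rewrite !inE; apply/idP/imsetP.
    case/andP=> /andP[sM pM] eM; exists (M :\ e); last by rewrite setD1K.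
    by rewrite inE setSD // partitionD1.
  case=> M'; rewrite inE subsetD1 => /andP[/andP[sM' eM'] pM'] ->.
  rewrite setU11 andbT subUset sub1set eE sM' /=.
  have -> : U = e :|: (U :\: e) by rewrite -{1}(setID U e) (setIidPr eU).
  apply: partitionU1 => //.
  by rewrite disjoint_sym disjoints_subset subsetDr.
move=> M1 M2; rewrite !inE !subsetD1 => /andP[/andP[_ e1] _] /andP[/andP[_ e2] _] eqM.
by rewrite -(setU1K e1) -(setU1K e2) eqM.
Qed.

(** No member of [E] straddles the two parts, so a cover splits into the members inside [U1] and
    those inside [U2]. Members being nonempty, this splitting is unique. *)
Lemma npartU E U1 U2 : set0 \notin E -> [disjoint U1 & U2] ->
  (forall e, e \in E -> e \subset U1 :|: U2 -> (e \subset U1) || (e \subset U2)) ->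
  npart E (U1 :|: U2) = (npart E U1 * npart E U2)%N.
Proof.
move=> E0 dU sE; rewrite /npart.
set X1 := [set M | _ & partition M U1]; set X2 := [set M | _ & partition M U2].
have not12 e : e \in E -> e \subset U1 -> e \subset U2 -> False.
  move=> eE e1 e2; move: E0; suff <- : e = set0 by rewrite eE.
  by apply/eqP; rewrite -subset0 -(disjoint_setI0 dU) subsetI e1.
rewrite -cardsX -[RHS](card_in_imset (f := fun M : {set {set V}} * {set {set V}} => M.1 :|: M.2)).
  apply: eq_card => M; rewrite inE; apply/idP/imsetP.
    case/andP=> sM pM; have sME e : e \in M -> e \in E by apply/subsetP.
    exists ([set e in M | e \subset U1], [set e in M | e \subset U2]); last first.
      apply/setP=> e; rewrite !inE -andb_orr.
      by case eM: (e \in M) => //; rewrite sE ?sME // (partitionS pM eM).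
    have /and3P[/eqP cM tM M0] := pM.
    have H (Ua Ub : {set V}) : Ua \subset U1 :|: U2 -> [disjoint Ua & Ub] ->
       (forall e, e \in M -> (e \subset Ua) || (e \subset Ub)) ->
       ([set e in M | e \subset Ua] \subset E) && partition [set e in M | e \subset Ua] Ua.
      move=> sUa dab sab; apply/andP; split.
        by apply/subsetP=> e; rewrite inE => /andP[/sME].
      apply/and3P; split.
      - rewrite eqEsubset; apply/andP; split.
          by apply/bigcupsP=> e; rewrite inE => /andP[].
        apply/subsetP=> v va; move: (subsetP sUa v va); rewrite -cM => /bigcupP[e eM ve].
        apply/bigcupP; exists e => //; rewrite inE eM /=.
        case/orP: (sab e eM) => // /subsetP/(_ v ve).
        by rewrite (disjointFr dab va).
      - by apply: trivIsetS tM; apply/subsetP=> e; rewrite inE => /andP[].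
      - by rewrite inE negb_and M0.
    rewrite !inE /=; apply/andP; split.
      apply: (H U1 U2) => //; first exact: subsetUl.
      by move=> e eM; rewrite sE ?sME // (partitionS pM eM).
    apply: (H U2 U1) => //; [exact: subsetUr | by rewrite disjoint_sym |].
    by move=> e eM; rewrite orbC sE ?sME // (partitionS pM eM).
  case=> -[M1 M2]; rewrite !inE /= => /andP[/andP[s1 p1] /andP[s2 p2]] ->.
  rewrite subUset s1 s2 /=.
  have /and3P[/eqP c1 t1 n1] := p1; have /and3P[/eqP c2 t2 n2] := p2.
  apply/and3P; split.
  - by rewrite /cover bigcup_setU -!/(cover _) c1 c2.
  - by apply: trivIsetU; rewrite // c1 c2.
  - by rewrite inE negb_or n1.
case=> [M1 M2] [M1' M2']; rewrite !inE /=.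
case/andP=> /andP[s1 p1] /andP[s2 p2] /andP[/andP[s1' p1'] /andP[s2' p2']] eqM.
(* For injectivity: a member of [M] occurring in [N'] would lie in both parts, so it must occur in
   [M']. *)
have F (M N M' N' : {set {set V}}) (A B : {set V}) :
    (forall e, e \in E -> e \subset A -> e \subset B -> False) ->
    M \subset E -> partition M A -> partition N' B -> M :|: N = M' :|: N' ->
    M \subset M'.
  move=> nAB sM pM pN' eqMN; apply/subsetP=> e eM.
  have : e \in M' :|: N' by rewrite -eqMN inE eM.
  rewrite inE => /orP[//|eN']; case: (nAB e).
  - exact: (subsetP sM).
  - exact: partitionS pM eM.
  - exact: partitionS pN' eN'.
have n21 e : e \in E -> e \subset U2 -> e \subset U1 -> False by move=> eE e2 /not12; apply.
congr (_, _); apply/eqP; rewrite eqEsubset.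
  rewrite (F _ _ _ _ _ _ not12 s1 p1 p2' eqM).
  by rewrite (F _ _ _ _ _ _ not12 s1' p1' p2 (esym eqM)).
rewrite setUC (setUC M1') in eqM.
rewrite (F _ _ _ _ _ _ n21 s2 p2 p1' eqM).
by rewrite (F _ _ _ _ _ _ n21 s2' p2' p1 (esym eqM)).
Qed.

End Partitions.

(** * Perfect matchings as exact covers by edges *)

Lemma set0_edges (G : sgraph) : set0 \notin edges G.
Proof.
rewrite inE; apply/existsP=> -[x /existsP[y /andP[_ /eqP/setP/(_ x)]]].
by rewrite !inE eqxx.
Qed.

Lemma in_edges (G : sgraph) (x y : G) : ([set x; y] \in edges G) = adj x y.
Proof.
rewrite inE; apply/idP/idP=> [|xy]; last first.
  by apply/existsP; exists x; apply/existsP; exists y; rewrite xy eqxx.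
case/existsP=> u /existsP[v /andP[uv /eqP E]].
have /orP[/eqP xE|/eqP xE] : (x == u) || (x == v) by move/setP/(_ x): E; rewrite !inE eqxx.
  have := set22 u v; rewrite -E !inE => /orP[/eqP vE|/eqP<-]; last by rewrite xE.
  by rewrite vE xE adj_irrefl in uv.
have := set21 u v; rewrite -E !inE => /orP[/eqP uE|/eqP<-]; last by rewrite xE adj_sym.
by rewrite uE xE adj_irrefl in uv.
Qed.

Lemma Pm_npart (G : sgraph) : Pm G = npart (edges G) [set: G].
Proof.
apply: eq_card => M; rewrite !inE; apply: andb_id2l => sM.
have M0 : set0 \notin M by apply: contra (set0_edges G); apply/subsetP.
rewrite /partition M0 andbT; apply/forallP/andP=> [H|[/eqP cM tM] v].
  have ex v : exists2 e, e \in M & v \in e.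
    have := H v; case/cards1P=> e /setP/(_ e); rewrite !inE eqxx => /andP[]; by exists e.
  split.
    by apply/eqP/setP=> v; rewrite inE; have [e eM ve] := ex v; apply/bigcupP; exists e.
  apply/trivIsetP=> a b aM bM; apply: contraR => /pred0Pn[v /andP[/= va vb]].
  have /cards1P[e /setP Ee] := H v.
  move: (Ee a) (Ee b); rewrite !inE aM bM va vb /=.
  by do 2!move/esym/eqP->.
have : v \in cover M by rewrite cM inE.
case/bigcupP=> e eM ve; apply/cards1P; exists e; apply/setP=> e'; rewrite !inE.
apply/andP/eqP=> [[e'M ve']|->//].
apply/eqP; apply: contraTT ve' => ne.
by rewrite (disjointFr (trivIsetP tM e e' eM e'M _) ve) // eq_sym.
Qed.

(** * Matching counts above a rooted vertex set, by branching on edges *)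

Definition o0 : 'I_4 := Ordinal (isT : 0 < 4)%N.
Definition o1 : 'I_4 := Ordinal (isT : 1 < 4)%N.
Definition o2 : 'I_4 := Ordinal (isT : 2 < 4)%N.
Definition o3 : 'I_4 := Ordinal (isT : 3 < 4)%N.

Definition I4 := [:: o0; o1; o2; o3].

Lemma mem_I4 i : i \in I4.
Proof. by case: i => [[|[|[|[|]]]] ?]. Qed.

(* [s] is the set of removed vertices in the copy of C4 above the root. *)
Definition fiber_count (a b c : nat) (s : 'I_4 -> bool) : nat :=
  match s o0, s o1, s o2, s o3 with
  | false, false, false, false => a
  | true, true, false, false | false, true, true, false
  | false, false, true, true | true, false, false, true => b
  | true, true, true, true => c
  | _, _, _, _ => 0
  end.

Definition add_to (s : 'I_4 -> bool) (i j : 'I_4) := (j == i) || s j.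

Section Deletion.
Variable V : finType.
Implicit Types (E : {set {set V}}) (X : seq {set V}) (U : {set V}).

(** Unfolds [npart_del] along [X]: each set is either discarded or used, and [f] counts the covers
    by the sets outside [X]. *)
Fixpoint del_count X (f : {set V} -> nat) U : nat :=
  if X is e :: X' then
    del_count X' f U + (if e \subset U then del_count X' f (U :\: e) else 0)
  else f U.

Lemma npart_del_count E X U : uniq X -> {subset X <= E} -> set0 \notin E ->
  npart E U = del_count X (npart (E :\: [set e in X])) U.
Proof.
elim: X E U => [|e X IHX] E U /=.
  by move=> _ _ _; congr (npart _ _); apply/setP=> e; rewrite !inE.
case/andP=> eX uX sXE E0; have eE : e \in E by apply: sXE; rewrite inE eqxx.
have -> : E :\: [set e0 in e :: X] = (E :\ e) :\: [set e0 in X].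
  by apply/setP=> e'; rewrite !inE negb_or; case: (e' == e); rewrite ?andbF.
have s' : {subset X <= E :\ e}.
  move=> e' e'X; rewrite !inE sXE ?inE ?e'X ?orbT // andbT.
  by apply: contraNneq eX => <-.
have E0' : set0 \notin E :\ e by rewrite !inE negb_and E0 orbT.
rewrite (npart_del _ eE) -?IHX //.
by apply: contraNneq E0 => <-.
Qed.

End Deletion.

Section Fibers.
Variable T : sgraph.
Let V : finType := cart_prod C4 T.
Let E : {set {set V}} := edges (cart_prod C4 T).
Implicit Types (r q : T) (W : {set T}) (s t : 'I_4 -> bool).

Definition region W r s : {set V} :=
  [set x | (x.2 \in W) && ~~ ((x.2 == r) && s x.1)].

Definition rung r q (i : 'I_4) : {set V} := [set (i, r); (i, q)].

Definition arc r (i : 'I_4) : {set V} := [set (i, r); (ordS i, r)].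

(* [I] lists the rungs still undecided; [s] and [t] are the vertices of the two
   fibres that are already covered. *)
Fixpoint glue (I : seq 'I_4) (g1 g2 : ('I_4 -> bool) -> nat) s t : nat :=
  if I is i :: I' then
    glue I' g1 g2 s t +
    (if ~~ s i && ~~ t i then glue I' g1 g2 (add_to s i) (add_to t i) else 0)
  else g1 s * g2 t.

(** Using the rung at [i] turns a pair of regions into a pair of the same kind, with [i] marked in
    both fibres; the two recursions therefore agree. *)
Lemma glue_del_count W1 W2 r q (I : seq 'I_4) (f : {set V} -> nat) g1 g2 :
  r \in W1 -> q \in W2 -> [disjoint W1 & W2] ->
  (forall s t, f (region W1 r s :|: region W2 q t) = (g1 s * g2 t)%N) ->
  forall s t, del_count (map (rung r q) I) f (region W1 r s :|: region W2 q t) =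
    glue I g1 g2 s t.
Proof.
move=> r1 q2 dW fE; have r2 : r \in W2 = false by rewrite (disjointFr dW).
have q1 : q \in W1 = false by rewrite (disjointFl dW).
have rq : r == q = false by apply: contraTF r1 => /eqP->; rewrite q1.
elim: I => [|i I IHI] s t /=; first exact: fE.
rewrite IHI; congr (_ + _)%N.
rewrite subUset !sub1set !inE /= r1 r2 q1 q2 !eqxx /= orbF.
case: ifP => // _; rewrite -IHI; congr del_count; apply/setP=> -[j x].
rewrite !inE /add_to !xpair_eqE /=.
case: (x =P r) => [->|_]; first by rewrite r1 r2 rq /= !andbT !andbF !orbF negb_or.
case: (x =P q) => [->|_]; last by rewrite !andbF.
by rewrite q1 q2 /= !andbT andbF !orFb negb_or.
Qed.

(** The only edges of the product joining the two sides are the rungs above [rq]. Once these are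
    decided, the count factors by [npartU]. *)
Lemma npart_region_glue W1 W2 r q (g1 g2 : ('I_4 -> bool) -> nat) :
  r \in W1 -> q \in W2 -> [disjoint W1 & W2] ->
  (forall x y, x \in W1 -> y \in W2 -> adj x y -> x = r /\ y = q) ->
  (forall s, npart E (region W1 r s) = g1 s) ->
  (forall s, npart E (region W2 q s) = g2 s) ->
  forall s, npart E (region (W1 :|: W2) r s) =
    glue (if adj r q then I4 else [::]) g1 g2 s xpred0.
Proof.
move=> r1 q2 dW cross G1 G2 s.
have d1 k : k \in W1 -> (k \in W2) = false by move/(disjointFr dW).
have d2 k : k \in W2 -> (k \in W1) = false by move/(disjointFl dW).
have -> : region (W1 :|: W2) r s = region W1 r s :|: region W2 q xpred0.
  apply/setP=> -[i x]; rewrite !inE /= andbF andbT.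
  by case: (x =P r) => [->|_]; rewrite ?r1 ?(d1 r r1) ?orbF //= !andbT.
set I := if _ then _ else _.
have E0 : set0 \notin E := set0_edges _.
have uI : uniq (map (rung r q) I).
  rewrite map_inj_uniq; first by rewrite /I; case: (adj r q).
  move=> i j /setP/(_ (i, r)); rewrite !inE eqxx !xpair_eqE /=.
  by move=> /esym/orP[] /andP[/eqP].
have sI : {subset map (rung r q) I <= E}.
  move=> e /mapP[i]; rewrite /I; case: ifP => // rq _ ->.
  by rewrite /E in_edges /= /cart_adj /= eqxx rq.
rewrite (npart_del_count _ uI sI E0); apply: glue_del_count => // {}s t.
set E' := E :\: _.
have E'E e : e \in E' -> e \in E by rewrite inE => /andP[].
have sub W (a : T) u (x : V) : x \in region W a u -> x.2 \in W by rewrite inE => /andP[].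
have dR : [disjoint region W1 r s & region W2 q t].
  apply/pred0P=> x /=; apply/negP=> /andP[/sub x1 /sub].
  by rewrite (d1 _ x1).
(* A rung has one end on each side, so deleting the rungs changes nothing within either region. *)
have nrung (e : {set V}) : (e \subset region W1 r s) || (e \subset region W2 q t) ->
    e \notin map (rung r q) I.
  move=> se; apply/mapP=> -[i _ eE]; move: se; rewrite eE !subUset !sub1set !inE /=.
  by rewrite r1 q2 (d1 _ r1) (d2 _ q2) /= andbF.
rewrite npartU //; first 1 last.
- by apply: contra E0; apply: E'E.
- move=> e; rewrite !inE => /andP[eI /existsP[x /existsP[y /andP[xy /eqP eE]]]].
  rewrite {}eE in eI *; rewrite !subUset !sub1set => /andP[xU yU].
  have := xy; rewrite /= /cart_adj => /orP[/andP[/eqP x1y1 axy]|/andP[_ /eqP x2y2]].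
    have rungP i a b : adj r q -> a = (i, r) -> b = (i, q) -> [set a; b] \in map (rung r q) I.
      by move=> rq -> ->; apply/mapP; exists i; rewrite // /I rq mem_I4.
    move: x y xU yU xy x1y1 axy eI => [i x] [j y] xU yU _ /= ij axy eI.
    rewrite -{j}ij in yU eI *.
    move: xU yU; rewrite !in_setU => /orP[xR|xR] /orP[yR|yR]; rewrite ?xR ?yR ?orbT //.
      have [/= xr yq] := cross _ _ (sub _ _ _ _ xR) (sub _ _ _ _ yR) axy.
      by rewrite (rungP i) ?xr ?yq // -xr -yq in eI.
    have := axy; rewrite adj_sym => ayx.
    have [/= yr xq] := cross _ _ (sub _ _ _ _ yR) (sub _ _ _ _ xR) ayx.
    by rewrite setUC (rungP i) ?yr ?xq // -yr -xq in eI.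
  move: xU yU; rewrite !in_setU => /orP[xR|xR] /orP[yR|yR]; rewrite ?xR ?yR ?orbT //.
    by have := sub _ _ _ _ yR; rewrite -x2y2 (d1 _ (sub _ _ _ _ xR)).
  by have := sub _ _ _ _ yR; rewrite -x2y2 (d2 _ (sub _ _ _ _ xR)).
by rewrite -G1 -G2; congr (_ * _)%N; apply: eq_npart => e se;
  rewrite in_setD in_set nrung // se ?orbT.
Qed.

(** The analogue of [glue] inside one fibre: [I] lists the undecided arcs, and a final choice counts
    when every vertex is covered. *)
Fixpoint cycle_count (I : seq 'I_4) s : nat :=
  if I is i :: I' then
    cycle_count I' s +
    (if ~~ s i && ~~ s (ordS i)
     then cycle_count I' (add_to (add_to s i) (ordS i)) else 0)
  else all s I4.

Lemma cycle_del_count r (I : seq 'I_4) (f : {set V} -> nat) :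
  (forall s, f (region [set r] r s) = all s I4) ->
  forall s, del_count (map (arc r) I) f (region [set r] r s) = cycle_count I s.
Proof.
move=> fE; elim: I => [|i I IHI] s /=; first exact: fE.
rewrite IHI subUset !sub1set !inE /= !eqxx /=; congr (_ + _)%N.
case: ifP => // _; rewrite -IHI; congr del_count; apply/setP=> -[j x].
rewrite !inE /add_to !xpair_eqE /=; case: (x =P r) => [_|_]; last by rewrite !andbF.
by rewrite !andbT /= !negb_or andbA (andbC (j != ordS i)).
Qed.

(** The four arcs are all the edges above a single vertex; after branching on them only the empty
    cover is left, and it fits only the empty region. *)
Lemma npart_region1 r s : npart E (region [set r] r s) = cycle_count I4 s.
Proof.
have uI : uniq (map (arc r) I4).
  rewrite map_inj_uniq // => i j /setP eij.
  move: (eij (i, r)) (eij (j, r)); rewrite !inE !eqxx !xpair_eqE !eqxx !andbT /= => {eij}.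
  (* Equal arcs would make each of [i], [j] equal to the other or its successor; in a 4-cycle this
     forces [i = j]. *)
  by case: i j => [[|[|[|[|i]]]] i4] [[|[|[|[|j]]]] j4] //= _ _; apply: val_inj.
have sI : {subset map (arc r) I4 <= E}.
  move=> e /mapP[i _ ->]; rewrite /E in_edges /= /cart_adj /= eqxx.
  by rewrite /C4_adj eqxx orbT.
rewrite (npart_del_count _ uI sI (set0_edges _)).
apply: cycle_del_count => {}s; transitivity (npart set0 (region [set r] r s)).
  apply: eq_npart => e se; rewrite [RHS]inE in_setD in_set andbC; apply/negbTE/negP.
  case/andP=> + eI; rewrite inE => /existsP[[i x] /existsP[[j y] /andP[xy /eqP eE]]].
  rewrite {}eE in se eI; move: se; rewrite subUset !sub1set !inE /=.
  case/andP=> /andP[/eqP xr _] /andP[/eqP yr _].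
  rewrite {}xr {}yr {x y} in xy eI; case/mapP: eI.
  move: xy; rewrite /= /cart_adj /= adj_irrefl andbF /= eqxx andbT /C4_adj.
  case/orP=> /eqP->; first by exists i; rewrite ?mem_I4.
  by exists j; rewrite ?mem_I4 // /arc setUC.
rewrite npart_set0; congr (nat_of_bool _); apply/eqP/idP => [s0|/allP sI4].
  by apply/allP=> i _; move/setP/(_ (i, r)): s0; rewrite !inE eqxx /= => /negbFE.
by apply/setP=> -[i x]; rewrite !inE /= sI4 ?mem_I4 // andbT andbN.
Qed.

(** [C4] has two perfect matchings, removing two neighbours leaves one edge, and removing everything
    leaves the empty matching. Any other removal leaves an odd number of vertices or two opposite
    ones. *)
Lemma cycle_countE s : cycle_count I4 s = fiber_count 2 1 1 s.
Proof.
have [s0 s1 s2 s3] : [/\ ordS o0 = o1, ordS o1 = o2, ordS o2 = o3 & ordS o3 = o0].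
  by split; apply: val_inj.
rewrite /fiber_count /= s0 s1 s2 s3 /add_to /=.
by case: (s o0); case: (s o1); case: (s o2); case: (s o3).
Qed.

(** From an empty [s], the useful rung sets are the empty one, the four neighbouring pairs and all
    four. From a neighbouring pair they are the empty set and the complementary pair; from a full
    fibre, only the empty set. *)
Lemma glueE (k : bool) a1 b1 c1 a2 b2 c2 s :
  glue (if k then I4 else [::]) (fiber_count a1 b1 c1) (fiber_count a2 b2 c2) s xpred0 =
  fiber_count (a1 * a2 + k * (4 * b1 * b2 + c1 * c2)) (b1 * a2 + k * (c1 * b2)) (c1 * a2) s.
Proof.
case: k => /=; rewrite /fiber_count /= /add_to /=;
  by case: (s o0); case: (s o1); case: (s o2); case: (s o3) => /=; ring.
Qed.

End Fibers.

(** * Characteristic polynomials of induced subgraphs *)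

Lemma det_principal_mx1 (R : comNzRingType) n (B : 'M[R]_n) (i : 'I_n) :
  \det (principal_mx B [set i]) = B i i.
Proof.
have -> : principal_mx B [set i] = diag_mx (\row_j if j == i then B i i else 1).
  apply/matrixP=> j k; rewrite !mxE !inE.
  case: (j =P i) => [->|_] /=; rewrite ?(eq_sym k i); last by [].
  by case: (i =P k) => [<-|]; rewrite ?eqxx.
rewrite det_diag (bigD1 i) //= big1 => [|j ji]; rewrite mxE ?eqxx ?mulr1 //.
by rewrite (negPf ji).
Qed.

Lemma det_principal_mx0 (R : comNzRingType) n (B : 'M[R]_n) :
  \det (principal_mx B set0) = 1.
Proof.
rewrite -(det1 R n); congr (\det _); apply/matrixP=> i j.
by rewrite !mxE inE.
Qed.

Section CharPoly.
Variables (F : fieldType) (T : sgraph).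
Implicit Types (r q : T) (W : {set T}).

(** By the padding, this is the characteristic polynomial of the subgraph induced on [W], computed
    with matrices of one fixed size. *)
Definition sub_char_poly W : {poly F} :=
  \det (principal_mx (char_poly_mx (adjmx F T)) [set i | enum_val i \in W]).

Lemma sub_char_polyT : sub_char_poly [set: T] = char_poly (adjmx F T).
Proof. by congr (\det _); apply/matrixP=> i j; rewrite mxE !inE. Qed.

Lemma sub_char_poly0 : sub_char_poly set0 = 1.
Proof.
rewrite /sub_char_poly -[RHS](det_principal_mx0 (char_poly_mx (adjmx F T))).
by congr (\det (principal_mx _ _)); apply/setP=> i; rewrite !inE.
Qed.

Lemma sub_char_poly1 r : sub_char_poly [set r] = 'X.
Proof.
rewrite /sub_char_poly.
have -> : [set i : 'I_#|T| | enum_val i \in [set r]] = [set enum_rank r].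
  by apply/setP=> i; rewrite !inE -(inj_eq enum_val_inj) enum_rankK.
by rewrite det_principal_mx1 !mxE adj_irrefl eqxx subr0.
Qed.

(** Both coupling entries are minus the adjacency of [r] and [q], and their product is that 0/1
    value again. *)
Lemma sub_char_polyU r q W1 W2 : r \in W1 -> q \in W2 -> [disjoint W1 & W2] ->
  (forall x y, x \in W1 -> y \in W2 -> adj x y -> x = r /\ y = q) ->
  sub_char_poly (W1 :|: W2) = sub_char_poly W1 * sub_char_poly W2 -
    (adj r q)%:R * (sub_char_poly (W1 :\ r) * sub_char_poly (W2 :\ q)).
Proof.
move=> r1 q2 dW cross; rewrite /sub_char_poly.
set B := char_poly_mx _; pose S W := [set i : 'I_#|T| | enum_val i \in W].
have SE W i : (i \in S W) = (enum_val i \in W) by rewrite inE.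
have SU W W' : S (W :|: W') = S W :|: S W' by apply/setP=> i; rewrite !inE.
have S1 W x : S (W :\ x) = S W :\ enum_rank x.
  by apply/setP=> i; rewrite !inE -(inj_eq enum_val_inj) enum_rankK.
have dne x y : x \in W1 -> y \in W2 -> x == y = false.
  by move=> x1; apply: contraTF => /eqP<-; rewrite (disjointFr dW x1).
have rq := dne r q r1 q2.
rewrite -!/(S _) SU !S1 (@det_principal_mxU _ _ _ _ _ (enum_rank r) (enum_rank q)).
- rewrite !mxE !enum_rankK !(inj_eq enum_rank_inj) rq (eq_sym q) rq adj_sym.
  by rewrite mulr0n sub0r mulrNN -polyCM -natrM mulnb andbb polyC_natr.
- apply/pred0P=> i /=; rewrite !inE; apply/negP=> /andP[i1].
  by rewrite (disjointFr dW i1).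
- by rewrite SE enum_rankK.
- by rewrite SE enum_rankK.
move=> i j; rewrite !SE => i1 j2 nij; rewrite !mxE.
have ij := dne _ _ i1 j2; rewrite (inj_eq enum_val_inj) in ij.
rewrite ij (eq_sym j) ij (adj_sym (enum_val j)).
case aij: (adj _ _) => /=; last by rewrite !polyC0 !mulr0n subrr.
have [ir jq] := cross _ _ i1 j2 aij.
by rewrite -ir -jq !enum_valK !eqxx in nij.
Qed.

Lemma sub_char_polyU0 W1 W2 : [disjoint W1 & W2] ->
  (forall x y, x \in W1 -> y \in W2 -> ~~ adj x y) ->
  sub_char_poly (W1 :|: W2) = sub_char_poly W1 * sub_char_poly W2.
Proof.
move=> dW nadj.
case: (set_0Vmem W1) => [->|[r r1]]; first by rewrite set0U sub_char_poly0 mul1r.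
case: (set_0Vmem W2) => [->|[q q2]]; first by rewrite setU0 sub_char_poly0 mulr1.
rewrite (@sub_char_polyU r q) ?(negPf (nadj _ _ r1 q2)) ?mul0r ?subr0 //.
by move=> x y x1 y2; rewrite (negPf (nadj _ _ x1 y2)).
Qed.

End CharPoly.

(** * The joint recurrence and the product formula *)

(** Writing the quadratic expressions as polynomials in the square of the variable allows evaluation
    at -2 although [F] may lack a square root of -2. *)
Lemma forest_region_char_poly (F : numFieldType) (T : sgraph) r (W : {set T}) :
  acyclic_graph T -> r \in W ->
  exists a b c : nat, exists al be ga : {poly F},
  [/\ forall s, npart (edges (cart_prod C4 T)) (region W r s) = fiber_count a b c s,
      [/\ sub_char_poly F W ^+ 2 = al \Po 'X^2,
          sub_char_poly F W * sub_char_poly F (W :\ r) = 'X * (be \Po 'X^2) &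
          sub_char_poly F (W :\ r) ^+ 2 = ga \Po 'X^2] &
      [/\ al.[-2] = (-1) ^+ #|W| * a%:R, be.[-2] = - ((-1) ^+ #|W| * b%:R) &
          ga.[-2] = - ((-1) ^+ #|W| * c%:R)]].
Proof.
move=> acT; move: r W; apply: forest_ind => // [r | r q W1 W2 r1 q2 dW cross].
  (* For a single vertex, P is the variable and Q is 1. *)
  exists 2%N, 1%N, 1%N, 'X, 1, 1; split.
  - by move=> s; rewrite npart_region1 cycle_countE.
  - by rewrite setDv sub_char_poly0 sub_char_poly1 comp_polyX -polyC1 comp_polyC
      polyC1 expr1n !mulr1.
  - by rewrite cards1 expr1 hornerX -polyC1 !hornerC; split; ring.
case=> a1 [b1 [c1 [al1 [be1 [ga1 [N1 [A1 B1 C1] [a1E b1E c1E]]]]]]].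
case=> a2 [b2 [c2 [al2 [be2 [ga2 [N2 [A2 B2 C2] [a2E b2E c2E]]]]]]].
have dW' : [disjoint W1 :\ r & W2] by apply: disjointWl dW; apply: subsetDl.
have WD : (W1 :|: W2) :\ r = (W1 :\ r) :|: W2.
  rewrite setDUl; congr (_ :|: _); apply/setDidPl.
  by rewrite disjoint_sym disjoints1 (disjointFr dW r1).
have cW : #|W1 :|: W2| = (#|W1| + #|W2|)%N.
  by rewrite cardsU (disjoint_setI0 dW) cards0 subn0.
have P12 := sub_char_polyU F r1 q2 dW cross.
have Q12 : sub_char_poly F ((W1 :|: W2) :\ r) =
    sub_char_poly F (W1 :\ r) * sub_char_poly F W2.
  rewrite WD sub_char_polyU0 // => x y; rewrite !inE => /andP[xr x1] y2.
  by apply: contra xr => xy; apply/eqP; case: (cross x y).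
set k := adj r q in P12.
exists (a1 * a2 + k * (4 * b1 * b2 + c1 * c2))%N, (b1 * a2 + k * (c1 * b2))%N, (c1 * a2)%N.
(* Obtained by squaring P1 P2 - k Q1 Q2. The cross term carries the square of the variable, here
   ['X], and at -2 its coefficient becomes the 4 of the gluing formula. *)
exists (al1 * al2 - (2 * k)%:R * 'X * be1 * be2 + k%:R * ga1 * ga2).
exists (be1 * al2 - k%:R * ga1 * be2), (ga1 * al2); split.
- by move=> s; rewrite (npart_region_glue r1 q2 dW cross N1 N2) glueE.
- have natC (m : nat) : (m%:R : {poly F}) \Po 'X^2 = m%:R by rewrite -polyC_natr comp_polyC.
  have kk : (k%:R : {poly F}) ^+ 2 = k%:R by case: (k); rewrite ?expr1n ?expr0n.
  rewrite Q12 P12 !(comp_polyB, comp_polyD, comp_polyM) !natC comp_polyX.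
  rewrite -A1 -A2 -C1 -C2.
  move: (sub_char_poly F W1) (sub_char_poly F W2) B1 B2 => p1 p2.
  move: (sub_char_poly F _) (sub_char_poly F _) => q2' q1.
  move: (be1 \Po _) (be2 \Po _) => x1 x2 B1 B2; split.
  + have -> : (2 * k)%:R * 'X^2 * x1 * x2 = 2 * k%:R * (p1 * q1) * (p2 * q2').
      by rewrite B1 B2 natrM; ring.
    by rewrite -{3}kk; ring.
  + have -> : (p1 * p2 - k%:R * (q1 * q2')) * (q1 * p2) =
        (p1 * q1) * p2 ^+ 2 - k%:R * q1 ^+ 2 * (p2 * q2') by ring.
    by rewrite B1 B2; ring.
  + by rewrite exprMn.
- rewrite -!polyC_natr !hornerE.
  rewrite a1E b1E c1E a2E b2E c2E cW exprD.
  rewrite !(natrD, natrM).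
  split; ring.
Qed.

Theorem theorem8 (F : numFieldType) (T : sgraph) (n : nat)
    (theta : 'I_n -> F) :
  is_tree T -> #|T| = n -> graph_eigenvalues T theta ->
  (Pm (cart_prod C4 T))%:R = \prod_(j < n) (2 + theta j ^+ 2) :> F.
Proof.
case=> [[/card_gt0P[r _] _] acT] Tn; rewrite /graph_eigenvalues => phiE.
have rT : r \in [set: T] by rewrite inE.
have [a [b [c [al [be [ga [Na [phi2 _ _] [alE _ _]]]]]]]] := forest_region_char_poly F acT rT.
rewrite sub_char_polyT {}phiE in phi2; rewrite cardsT Tn in alE.
have -> : Pm (cart_prod C4 T) = a.
  rewrite Pm_npart -[RHS]/(fiber_count a b c xpred0) -Na; congr (npart _ _).
  by apply/setP=> x; rewrite !inE andbF.
set phi := \prod_(j < n) _ in phi2.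
(* The aim is [phi' = phi], the symmetry of the spectrum about 0. *)
pose phi' := \prod_(j < n) ('X - (- theta j)%:P).
(* The square of [phi] is a polynomial in the squared variable, hence even. *)
have phi'2 : phi' ^+ 2 = phi ^+ 2.
  have phiN : phi \Po - 'X = (-1) ^+ n * phi'.
    rewrite /phi rmorph_prod /= -[in RHS](card_ord n) -prodr_const -big_split /=.
    by apply: eq_bigr => j _; rewrite comp_polyB comp_polyX comp_polyC polyCN; ring.
  transitivity ((phi \Po - 'X) ^+ 2).
    by rewrite phiN exprMn -exprM mulnC exprM sqrrN !expr1n mul1r.
  rewrite -rmorphXn /= phi2 -comp_polyA; congr (_ \Po _).
  by rewrite comp_Xn_poly sqrrN.
(* The two agree up to sign; both being monic, the sign is plus because 2 is nonzero in [F]. *)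
have phi'E : phi' = phi.
  have [mphi mphi'] : phi \is monic /\ phi' \is monic by split; apply: monic_prod_XsubC.
  move/eqP: phi'2; rewrite eqf_sqr => /orP[/eqP//|/eqP phiN].
  have := monicP mphi'; rewrite phiN lead_coefN (monicP mphi) => /eqP.
  by rewrite -subr_eq0 -opprD oppr_eq0 (Num.Theory.pnatr_eq0 F 2).
have -> : \prod_(j < n) (2 + theta j ^+ 2) =
    (-1) ^+ n * (\prod_(j < n) ('X - (theta j ^+ 2)%:P)).[-2].
  rewrite horner_prod -[in (-1) ^+ _](card_ord n) -prodr_const -big_split /=.
  by apply: eq_bigr => j _; rewrite !hornerE; ring.
suff <- : al = \prod_(j < n) ('X - (theta j ^+ 2)%:P).
  by rewrite alE mulrA -exprMn mulrNN mulr1 expr1n mul1r.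
(* Composition with ['X^2] is injective, and after it [al] becomes [phi * phi'], whose paired
   factors are differences of squares. *)
apply/eqP; rewrite -subr_eq0 -(@comp_poly_eq0 _ _ 'X^2) ?size_polyXn //.
rewrite comp_polyB -phi2 expr2 -{2}phi'E -big_split rmorph_prod subr_eq0 /=.
apply/eqP/eq_bigr => j _; rewrite comp_polyB comp_polyX comp_polyC.
by rewrite polyCN rmorphXn /=; ring.
Qed.
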